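(* Let $m\in\mathbb{N}$, $m\ge1$, let $A\subseteq\mathbb{N}^m$ be a finite non-empty complete set of multi-indices, and let $\Pi_A\subseteq\Pi_m$ be the polynomial subspace induced by $A$. For $i=1,\dots,m$ let $n_i=\max_{\alpha\in A}\alpha_i$ and let $P_i=\{p_{0,i},\dots,p_{n_i,i}\}\subseteq\mathbb{R}$ be an arbitrary set of $n_i+1$ pairwise distinct real numbers. Then the node set $$P_A=\{(p_{\alpha_1,1},\dots,p_{\alpha_m,m}) : \alpha\in A\}\subseteq\mathbb{R}^m$$ is unisolvent with respect to $\Pi_A$.
   Context: $\mathbb{N}$ contains $0$ when used for multi-indices. $\Pi_m$ is the real vector space of real polynomials in $x_1,\dots,x_m$, and $\Pi_A=\mathrm{span}\{x^\alpha : \alpha\in A\}$ with $x^\alpha=x_1^{\alpha_1}\cdots x_m^{\alpha_m}$. $A\subseteq\mathbb{N}^m$ is complete (downward closed) if whenever $\alpha\in A$ and $\beta\in\mathbb{N}^m$ satisfy $\beta_i\le\alpha_i$ for all $i$, then $\beta\in A$. A finite non-empty set $P\subseteq\mathbb{R}^m$ is unisolvent with respect to a subspace $\Pi\subseteq\Pi_m$ if there is no $Q\in\Pi\setminus\{0\}$ with $Q(p)=0$ for all $p\in P$. *)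

(* Defs.v *)
From mathcomp Require Import all_boot all_order all_algebra.
From mathcomp Require Import finmap reals mpoly.

Set Implicit Arguments.
Unset Strict Implicit.
Unset Printing Implicit Defensive.

Import GRing.Theory.

Local Open Scope ring_scope.

Definition complete (m : nat) (A : {fset 'X_{1..m}}) : Prop :=
  forall a b : 'X_{1..m}, a \in A -> (forall i, (b i <= a i)%N) -> b \in A.

Record mpoly_subspace (R : realType) (m : nat) := MpolySubspace {
  in_subspace :> {mpoly R[m]} -> Prop;
  in_subspace0 : in_subspace 0;
  in_subspaceP : forall (c : R) (p q : {mpoly R[m]}),
    in_subspace p -> in_subspace q -> in_subspace (c *: p + q)
}.

Definition monomial_span (R : realType) (m : nat) (A : {fset 'X_{1..m}})
    (Q : {mpoly R[m]}) : Prop :=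
  exists c : 'X_{1..m} -> R, Q = \sum_(a <- A) c a *: 'X_[a].

Lemma monomial_span0 (R : realType) (m : nat) (A : {fset 'X_{1..m}}) :
  monomial_span A (0 : {mpoly R[m]}).
Proof.
by exists (fun=> 0); rewrite big1 // => a _; rewrite scale0r.
Qed.

Lemma monomial_spanP (R : realType) (m : nat) (A : {fset 'X_{1..m}})
    (k : R) (p q : {mpoly R[m]}) :
  monomial_span A p -> monomial_span A q -> monomial_span A (k *: p + q).
Proof.
move=> [c ->] [d ->]; exists (fun a => k * c a + d a).
rewrite scaler_sumr -big_split; apply: eq_bigr => a _.
by rewrite scalerDl scalerA.
Qed.

Definition Pi_ (R : realType) (m : nat) (A : {fset 'X_{1..m}}) :
    mpoly_subspace R m :=
  MpolySubspace (monomial_span0 R A) (@monomial_spanP R m A).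

Definition unisolvent (R : realType) (m : nat) (P : {fset 'rV[R]_m})
    (Pi : mpoly_subspace R m) : Prop :=
  P != fset0 /\
  ~ exists Q : {mpoly R[m]},
      [/\ Pi Q, Q != 0 & forall x : 'rV[R]_m, x \in P -> Q.@[x ord0] = 0].

Definition maxdeg (m : nat) (A : {fset 'X_{1..m}}) (i : 'I_m) : nat :=
  \max_(a <- A) a i.

(* [p i j] is the point $p_{j,i}$ of $P_i$; only its values with
   [j <= maxdeg A i] are used. *)
Definition nodes (R : realType) (m : nat) (A : {fset 'X_{1..m}})
    (p : 'I_m -> nat -> R) : {fset 'rV[R]_m} :=
  [fset (\row_i p i (a i))%R | a : 'X_{1..m} in A]%fset.

(* Main.v *)
Require Import Defs.
From mathcomp Require Import all_boot all_order all_algebra.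
From mathcomp Require Import finmap reals mpoly.

Set Implicit Arguments.
Unset Strict Implicit.
Unset Printing Implicit Defensive.

(**
Divided differences detect leading coefficients: the functional
[p_{0,i}, ..., p_{k,i}] sends t^j to 0 for j < k and t^k to 1. For b in A, the
tensor product over i of the functionals of orders b_i kills every monomial x^a
such that a_i < b_i for some i, hence every x^a with |a| <= |b| and a <> b, and
it sends x^b to 1. It is a combination of evaluations at nodes indexed by
multi-indices c <= b, all of which lie in A by completeness. Applied to a nonzero
Q in Pi_A vanishing on P_A, with b the leading monomial of Q, it shows that the
leading coefficient of Q is zero.
*)

Import GRing.Theory.

Local Open Scope ring_scope.

(** The conditions on [w] form a square linear system with the Vandermonde matrix of [x 0], ...,
    [x n], invertible because the nodes are distinct; [w] is the last column of its inverse. *)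
Lemma divided_difference (F : fieldType) (n : nat) (x : nat -> F) :
    (forall j k, (j <= n)%N -> (k <= n)%N -> x j = x k -> j = k) ->
  exists w : nat -> F, forall a, (a <= n)%N ->
    \sum_(j < n.+1) w j * x j ^+ a = (a == n)%:R.
Proof.
move=> x_inj; pose V := Vandermonde n.+1 (\row_(j < n.+1) x j).
have V_unit : V \in unitmx.
  rewrite unitmxE unitfE det_Vandermonde.
  apply/prodf_neq0 => i _; apply/prodf_neq0 => j lt_ij; rewrite !mxE subr_eq0.
  by apply: contraTneq lt_ij => /x_inj <-; rewrite ?ltnn // -ltnS.
pose w := invmx V *m delta_mx ord_max 0 : 'cV_n.+1.
exists (fun j => w (inord j) 0) => a le_an.
have /matrixP/(_ (inord a) 0) : V *m w = delta_mx ord_max 0 by rewrite mulKVmx.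
rewrite !mxE eqxx andbT -val_eqE /= inordK ?ltnS // => <-.
by apply: eq_bigr => j _; rewrite !mxE inord_val inordK ?ltnS // mulrC.
Qed.

Lemma mnm_eq_le_mdeg (m : nat) (a b : 'X_{1..m}) :
  (mdeg a <= mdeg b)%N -> (forall i, b i <= a i)%N -> a = b.
Proof.
move=> le_ab /mnm_lepP le_ba; have := le_ab.
rewrite -{1}(submK le_ba) mdegD -[leqRHS]add0n leq_add2r leqn0 mdeg_eq0.
by move=> /eqP ab0; rewrite -(submK le_ba) ab0 add0m.
Qed.

(** The range of [f i] depends on [i], so all indices live in one type, large enough as
    [b i <= mdeg b], and [family] restores the bounds. *)
Lemma tensor_divided_difference (F : fieldType) (m : nat) (b : 'X_{1..m})
    (p : 'I_m -> nat -> F) :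
    (forall i j k, (j <= b i)%N -> (k <= b i)%N -> p i j = p i k -> j = k) ->
  exists w : {ffun 'I_m -> 'I_(mdeg b).+1} -> F,
    forall a : 'X_{1..m}, (mdeg a <= mdeg b)%N ->
    \sum_(f in family (fun i (j : 'I_(mdeg b).+1) => j <= b i)%N)
       w f * \prod_i p i (f i) ^+ a i = (a == b)%:R.
Proof.
move=> p_inj.
have [w wP] := fin_all_exists (fun i => divided_difference (p_inj i)).
exists (fun f : {ffun 'I_m -> 'I_(mdeg b).+1} => \prod_i w i (f i)) => a le_ab.
under eq_bigr do rewrite -big_split /=.
(* The sum over the grid factors into a product of one-variable sums. *)
rewrite -(bigA_distr_big_dep _
    (fun i (j : 'I_(mdeg b).+1) => w i j * p i j ^+ a i)).
transitivity (\prod_i \sum_(j < (b i).+1) w i j * p i j ^+ a i).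
  apply: eq_bigr => i _.
  have le_bi : ((b i).+1 <= (mdeg b).+1)%N.
    by rewrite ltnS mdegE (bigD1 i) //= leq_addr.
  by rewrite (big_ord_widen _ (fun j => w i j * p i j ^+ a i) le_bi).
have [->|neq_ab] := eqVneq a b.
  by rewrite big1 // => i _; rewrite wP ?eqxx.
have /existsP[i lt_ai] : [exists i, (a i < b i)%N].
  apply: contraNT neq_ab => /existsPn ge_ab; apply/eqP/mnm_eq_le_mdeg => // i.
  by rewrite leqNgt.
(* Other factors may have [a] beyond the exponents covered by [wP]; one zero factor suffices. *)
by rewrite (bigD1 i) //= wP ?(ltnW lt_ai) // (ltn_eqF lt_ai) mul0r.
Qed.

Lemma msupp_monomial_span (R : realType) (m : nat) (A : {fset 'X_{1..m}})
    (Q : {mpoly R[m]}) :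
  monomial_span A Q -> {subset msupp Q <= A}.
Proof.
move=> [c ->] b; rewrite mcoeff_msupp; apply: contraNT => bNA.
rewrite raddf_sum /= big_seq big1 // => a aA.
by rewrite mcoeffZ mcoeffX; case: eqVneq bNA => [<-|]; rewrite ?aA // mulr0.
Qed.

Lemma leq_maxdeg (m : nat) (A : {fset 'X_{1..m}}) (a : 'X_{1..m}) (i : 'I_m) :
  a \in A -> (a i <= maxdeg A i)%N.
Proof. by move=> aA; exact: (leq_bigmax_seq (F := fun a : 'X_{1..m} => a i)). Qed.

Theorem corollary2p9 (R : realType) (m : nat) (m_ge1 : (1 <= m)%N)
    (A : {fset 'X_{1..m}}) (A_neq0 : A != fset0) (A_complete : complete A)
    (p : 'I_m -> nat -> R)
    (p_distinct : forall (i : 'I_m) (j k : nat),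
       (j <= maxdeg A i)%N -> (k <= maxdeg A i)%N -> p i j = p i k -> j = k) :
  unisolvent (nodes A p) (Pi_ R A).
Proof.
split.
  have [a aA] := fset0Pn _ A_neq0.
  by apply/fset0Pn; exists (\row_i p i (a i)); apply/imfsetP; exists a.
move=> [Q [/msupp_monomial_span sQA Q_neq0 Q_vanish]].
set b := mlead Q.
have bA : b \in A by apply/sQA/mlead_supp.
have p_inj i j k : (j <= b i)%N -> (k <= b i)%N -> p i j = p i k -> j = k.
  have le_bi := leq_maxdeg i bA.
  by move=> jb kb; apply: p_distinct; [exact: leq_trans jb _|exact: leq_trans kb _].
have [w wP] := tensor_divided_difference p_inj.
have : \sum_(f in family (fun i (j : 'I_(mdeg b).+1) => j <= b i)%N)
    w f * Q.@[fun i => p i (f i)] = 0.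
  apply: big1 => f /familyP f_le_b; rewrite -[RHS](mulr0 (w f)); congr (_ * _).
  pose c := [multinom (f i : nat) | i < m].
  have cA : c \in A by apply: A_complete bA _ => i; rewrite mnmE; exact: f_le_b.
  rewrite -(Q_vanish (\row_i p i (c i))); last by apply/imfsetP; exists c.
  by apply: mpoly.meval_eq => i; rewrite mxE mnmE.
under eq_bigr do rewrite mevalE mulr_sumr.
(* The monomial order compares total degrees first, so every monomial in the support of [Q] has
   degree at most [mdeg b], as [wP] requires. *)
rewrite exchange_big /= (eq_big_seq (fun a => Q@_a * (a == b)%:R)); last first.
  move=> a /msupp_le_mlead/lemc_mdeg/wP <-; rewrite mulr_sumr.
  by apply: eq_bigr => f _; rewrite mulrCA.
rewrite (bigD1_seq b) ?mlead_supp ?msupp_uniq //= eqxx mulr1 big1 => [|a].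
  by rewrite addr0 => /eqP; rewrite mleadc_eq0 (negPf Q_neq0).
by move=> /negPf ->; rewrite mulr0.
Qed.
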